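(* Let $\pi : A\to B$ be a surjective map between nonempty countable sets. Let $p\in [0,1]$. Let $(X_b)_{b\in B}$ be a collection of independent random variables with Bernoulli distribution of parameter $p$. On the same probability space, let $(S(b))_{b\in B}$ be a collection of random variables such that, for every $b\in B$, the random variable $S(b)$ takes values in $\pi^{-1}(\{b\})$ (the $S(b)$ may be arbitrarily correlated with each other and with $(X_b)$). For every $a\in A$, set $Y_a:=X_{\pi(a)}$ if $S(\pi(a))=a$ and $Y_a:=0$ otherwise. Then the distribution of $(Y_a)_{a\in A}$ is stochastically dominated by $\mathrm{Bernoulli}(p)^{\otimes A}$.
   Context: ''Countable'' means finite or countably infinite. $\{0,1\}^A$ is ordered by the product (coordinatewise) order. A probability measure $\mu$ is stochastically dominated by $\nu$ if there exist random variables $X\sim\mu$ and $Y\sim\nu$ on a common probability space with $X\le Y$ almost surely. *)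

(* Defs.v *)
From HB Require Import structures.
From mathcomp Require Import all_boot all_order all_algebra.
From mathcomp Require Import all_classical all_reals all_analysis.
Set Implicit Arguments. Unset Strict Implicit. Unset Printing Implicit Defensive.
Import Order.TTheory GRing.Theory Num.Theory.
Local Open Scope classical_set_scope.
Local Open Scope ring_scope.

Definition discrete_rv d (Omega : measurableType d) (T : Type) (Z : Omega -> T) :=
  forall t : T, measurable [set w | Z w = t].

(* (Z_i)_{i in I} are (mutually) independent random variables, each with
   Bernoulli(p) distribution: for every finite family F of distinct indices
   and every choice of values v, P(Z_i = v_i for all i in F) = prod p^{v_i}(1-p)^{1-v_i}.
   (For {0,1}-valued variables this is exactly mutual independence together
   with the Bernoulli(p) marginals.) *)
Definition iid_bernoulli d (Omega : measurableType d) (R : realType)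
  (P : probability Omega R) (p : R) (I : eqType) (Z : I -> Omega -> bool) :=
  forall (F : seq I), uniq F -> forall v : I -> bool,
    P (\bigcap_(i in [set` F]) [set w | Z i w = v i])
    = (\prod_(i <- F) (bernoulli_pmf p (v i))%:E)%E.

Definition prod_sigma (A : Type) : set (set (A -> bool)) :=
  <<s [set [set f : A -> bool | f a = true] | a in [set: A]] >>.

Definition thinned (Omega : Type) (A : eqType) (B : Type) (pi : A -> B) (X : B -> Omega -> bool)
  (S : B -> Omega -> A) : Omega -> A -> bool :=
  fun w a => (S (pi a) w == a) && X (pi a) w.

Definition law d (Omega : measurableType d) (R : realType)
  (P : probability Omega R) (A : Type) (U : Omega -> A -> bool) :
  set (A -> bool) -> \bar R := fun E => P (U @^-1` E).

Definition dominated_by_bernoulli_product d (Omega : measurableType d)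
  (R : realType) (P : probability Omega R) (A : eqType) (Y : Omega -> A -> bool)
  (p : R) : Prop :=
  exists (d' : measure_display) (Omega' : measurableType d')
         (P' : probability Omega' R) (U V : Omega' -> A -> bool),
    [/\ forall a : A, discrete_rv (fun w => U w a),
        forall a : A, discrete_rv (fun w => V w a),
        forall E, prod_sigma E -> law P' U E = law P Y E,
        iid_bernoulli P' p (fun a w => V w a) &
        \forall w \ae P', forall a : A, U w a ==> V w a].

(* Main.v *)
(* Write Y for the thinned field.  It satisfies Y a <= X (pi a) and has at most one 1 in each fibre.
   On finitely many coordinates, peel the elements a off their fibres one by one: the bit of the
   fibre is split into two independent Bernoulli(p) bits, one for a and one for the rest of the
   fibre.  When the fibre bit is 1, it is handed to a if Y a = 1 and to the rest otherwise; when it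
   is 0, the recipient is chosen with the conditional probability of Y a = 1 given that the fibre
   bit is 1 and given all the other bits.  The recipient is then independent of the fibre bit, so
   the split bits stay i.i.d. while dominating Y, and the law of Y is never changed.  Couplings for
   a growing sequence of finite sets need not be consistent; an ultrafilter limit gives a finitely
   additive coupling on {0,1}^N, whose cylinder weights are realised by nested subintervals of
   [0,1] under Lebesgue measure. *)
Require Import Defs.
From HB Require Import structures.
From mathcomp Require Import all_boot all_order all_algebra.
From mathcomp Require Import all_classical all_reals all_analysis.
From mathcomp Require Import ring lra.
Set Implicit Arguments. Unset Strict Implicit. Unset Printing Implicit Defensive.
Import Order.TTheory GRing.Theory Num.Theory.
Local Open Scope classical_set_scope.
Local Open Scope ring_scope.

(** * Realising a finitely additive weight on binary sequences by digits of a uniform real *)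

Section Realization.
Context {R : realType} (mu : set (nat -> bool) -> R).
Hypothesis mu_ge0 : forall E, 0 <= mu E.
Hypothesis mu_setT : mu setT = 1.
Hypothesis mu_split : forall E D, mu E = mu (E `&` D) + mu (E `\` D).

(* Words list the most recent letter first.  The reals with digit word [s] form the interval
   [left_end s, left_end s + mu (cyl s)). *)
Fixpoint cyl (s : seq bool) : set (nat -> bool) :=
  if s is b :: s' then cyl s' `&` [set w | w (size s') = b] else setT.

Fixpoint left_end (s : seq bool) : R :=
  if s is b :: s' then left_end s' + (if b then mu (cyl (false :: s')) else 0)
  else 0.

(** A greedy expansion: the next letter tells on which side of the cut point between the two
    subintervals of the current word the real [x] lies. *)
Fixpoint digits (x : R) (k : nat) : seq bool :=
  if k is k'.+1 then
    let s := digits x k' in (left_end s + mu (cyl (false :: s)) <= x) :: s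
  else [::].

(** The default [false] is never returned, since [digits x k.+1] is nonempty. *)
Definition digit (x : R) (k : nat) : bool := head false (digits x k.+1).

Lemma digitsE x s : (digits x (size s) = s) <-> cyl s (digit x).
Proof.
elim: s => [//|b s [IH1 IH2]] /=; rewrite /digit /=; split.
  by case=> h1 h2; rewrite h2 in h1 *; rewrite h1; split=> //; exact: IH1.
by move=> [/IH2 ->] ->.
Qed.

Lemma mu_cyl_split s : mu (cyl s) = mu (cyl (false :: s)) + mu (cyl (true :: s)).
Proof.
rewrite (mu_split (cyl s) [set w | w (size s) = false]) /=; congr (_ + mu _).
by apply/seteqP; split=> w /= [h1]; [case: (w _) | move=> ->].
Qed.

(** The masses of [false :: s] and [true :: s] add up to that of [s], so the cut point divides the
    interval of [s] exactly into theirs. A word of mass zero gets an empty interval. *)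
Lemma digits_interval x s : 0 <= x < 1 ->
  (digits x (size s) = s) <-> (left_end s <= x < left_end s + mu (cyl s)).
Proof.
move=> x01; elim: s => [|b s [IH1 IH2]] /=.
  by rewrite mu_setT add0r; split.
have split := mu_cyl_split s; have t0 := mu_ge0 (cyl (true :: s)).
have f0 := mu_ge0 (cyl (false :: s)).
rewrite /= in split t0 f0; split.
  move=> [h1 h2]; move: h1; have := IH1 h2; rewrite h2 => /andP[l1 l2].
  by case: b => h1; apply/andP; split; lra.
move=> /andP[l1 l2]; rewrite IH2 //; last by case: b l1 l2 => l1 l2; lra.
by congr cons; case: b l1 l2 => l1 l2; lra.
Qed.

Lemma left_end_bounds s : 0 <= left_end s /\ left_end s + mu (cyl s) <= 1.
Proof.
elim: s => [|b s [l0 l1]]; first by rewrite /= mu_setT add0r.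
have := mu_cyl_split s; have := mu_ge0 (cyl (true :: s)).
have := mu_ge0 (cyl (false :: s)).
by case: b => /= f0 t0 h; split; lra.
Qed.

Lemma measurable_digits k s : measurable [set x : measurableTypeR R | digits x k = s].
Proof.
elim: k s => [|k IH] [|b s] /=.
- by rewrite (_ : [set _ | _] = setT) //; apply/seteqP; split.
- by rewrite (_ : [set _ | _] = set0) //; apply/seteqP; split.
- by rewrite (_ : [set _ | _] = set0) //; apply/seteqP; split.
pose c := left_end s + mu (cyl (false :: s)).
rewrite (_ : [set _ | _] = [set x : measurableTypeR R | digits x k = s] `&`
   [set` if b then `[c, +oo[ else `]-oo, c[ ]).
  by apply: measurableI => //; exact: measurable_itv.
apply/seteqP; split=> x /=.
  move=> [h1 h2]; split => //; rewrite h2 /= -/c in h1; case: b h1 => /= h1.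
    by rewrite in_itv /= h1.
  by rewrite in_itv /= ltNge h1.
move=> [-> h]; congr cons; case: b h => /=; rewrite in_itv /= -/c ?andbT //.
by rewrite ltNge => /negbTE.
Qed.

Lemma measurable_digit k b : measurable [set x : measurableTypeR R | digit x k = b].
Proof.
rewrite (_ : [set _ | _] = \bigcup_(s : seq bool)
  [set x : measurableTypeR R | digits x k.+1 = b :: s]).
  by apply: countable_bigcupT_measurable => // s; exact: measurable_digits.
apply/seteqP; split=> x; rewrite /digit /=; first by move=> <-; exists (digits x k).
by move=> [s _ [-> _]].
Qed.

Lemma measurable_digit_cyl s : measurable [set x : measurableTypeR R | cyl s (digit x)].
Proof.
rewrite (_ : [set _ | _] = [set x : measurableTypeR R | digits x (size s) = s]).
  exact: measurable_digits.
by apply/seteqP; split=> x /= /digitsE.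
Qed.

Lemma uniform01E (D : set (measurableTypeR R)) : measurable D ->
  uniform_prob (@ltr01 R) D = lebesgue_measure (D `&` `[0, 1]).
Proof.
move=> mD; rewrite /uniform_prob integral_uniform_pdf.
rewrite (eq_integral (fun=> 1%:E)); last first.
  by move=> x; rewrite inE /= => -[_]; rewrite /uniform_pdf in_itv /= => ->; rewrite subr0 invr1.
by rewrite integral_cst ?mul1e //; exact: measurableI.
Qed.

Lemma uniform01_digit_cyl s :
  uniform_prob (@ltr01 R) [set x | cyl s (digit x)] = (mu (cyl s))%:E.
Proof.
have [l0 l1] := left_end_bounds s; have m0 := mu_ge0 (cyl s).
have mC := measurable_digit_cyl s.
rewrite uniform01E //.
set C := [set x | _] in mC *.
have mCI (i : interval R) : measurable (C `&` [set` i]) by apply: measurableI.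
(* The interval description of digit words is only available below 1; the endpoint 1 is a null set
   and is dropped. *)
have -> : lebesgue_measure (C `&` `[0, 1]) = lebesgue_measure (C `&` `[0, 1[).
  apply/eqP; rewrite eq_le; apply/andP; split; last first.
    apply: le_measure; rewrite ?inE //; apply: setIS => x /=.
    by rewrite !in_itv /= => /andP[-> /ltW ->].
  rewrite -[leRHS]adde0 -(@lebesgue_measure_set1 R 1).
  apply: le_trans (measureU2 _ _ _) => //.
  apply: le_measure; rewrite ?inE //; first by apply: measurableU.
  move=> x [Cx] /=; rewrite in_itv /= => /andP[x0]; rewrite le_eqVlt => /orP[/eqP ->|x1].
    by right.
  by left; split => //=; rewrite in_itv /= x0.
rewrite (_ : C `&` _ = `[left_end s, left_end s + mu (cyl s)[%classic).
  rewrite lebesgue_measure_itv /= lte_fin -EFinB.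
  case: ifPn => h; first by congr EFin; ring.
  by congr EFin; move: h; rewrite -leNgt; lra.
apply/seteqP; split => x /=; rewrite !in_itv /=.
  by move=> [/digitsE h1 h2]; apply/digits_interval.
move=> /andP[h1 h2]; have x01 : 0 <= x < 1 by apply/andP; split; lra.
by split => //; apply/digitsE/digits_interval => //; rewrite h1 h2.
Qed.

Lemma mu_set0 : mu set0 = 0.
Proof. by have := mu_split set0 set0; rewrite setI0 setD0; lra. Qed.

(** An event read off the first [k] coordinates is a finite disjoint union of cylinders, so finite
    additivity of [mu] suffices. *)
Lemma uniform01_digit k (E : set (nat -> bool)) :
  (forall w w' : nat -> bool, (forall i, (i < k)%N -> w i = w' i) -> E w -> E w') ->
  measurable [set x : measurableTypeR R | E (digit x)] /\
  uniform_prob (@ltr01 R) [set x | E (digit x)] = (mu E)%:E.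
Proof.
move=> Ek.
(* [j] counts the coordinates below [k] not yet fixed by [s]. At [j = 0] the word decides [E], so
   the intersection is empty or the whole cylinder; otherwise the next letter is split. *)
suff H j s : (size s + j)%N = k ->
    measurable [set x : measurableTypeR R | (cyl s `&` E) (digit x)] /\
    uniform_prob (@ltr01 R) [set x | (cyl s `&` E) (digit x)] = (mu (cyl s `&` E))%:E.
  by rewrite -[E]setTI; exact: H k [::] erefl.
have cylE t w w' : cyl t w -> cyl t w' -> forall i, (i < size t)%N -> w i = w' i.
  elim: t => [//|b t IH] /= [h1 h2] [h3 h4] i; rewrite ltnS leq_eqVlt => /orP[/eqP ->|].
    by rewrite h2 h4.
  exact: IH.
elim: j s => [|j IH] s sk.
  have [->|/set0P[w [sw Ew]]] := eqVneq (cyl s `&` E) set0.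
    rewrite (_ : [set x | _] = set0); last by apply/seteqP; split.
    by rewrite measure0 mu_set0.
  have -> : cyl s `&` E = cyl s.
    apply/setIidPl => w' sw'; apply: Ek Ew => i ik; apply: cylE sw sw' _ _.
    by rewrite addn0 in sk; rewrite sk.
  by split; [exact: measurable_digit_cyl|exact: uniform01_digit_cyl].
have sk' : ((size s).+1 + j)%N = k by rewrite addSn -addnS.
have [m1 e1] := IH (true :: s) sk'; have [m2 e2] := IH (false :: s) sk'.
have EU : [set x | (cyl s `&` E) (digit x)] =
   [set x | (cyl (true :: s) `&` E) (digit x)] `|` [set x | (cyl (false :: s) `&` E) (digit x)].
  apply/seteqP; split=> x /=; last by move=> [] [[? ?] ?].
  by move=> [? ?]; case e : (digit x (size s)); [left|right].
rewrite EU; split; first exact: measurableU.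
have -> : forall D1 D2 : set (measurableTypeR R), measurable D1 -> measurable D2 ->
    D1 `&` D2 = set0 ->
    uniform_prob (@ltr01 R) (D1 `|` D2)
    = (uniform_prob (@ltr01 R) D1 + uniform_prob (@ltr01 R) D2)%E.
- by move=> D1 D2; exact: measureU.
- rewrite (mu_split (cyl s `&` E) [set w | w (size s) = true]) EFinD.
  rewrite e1 e2; congr (_ + _)%E; congr (mu _)%:E; apply/seteqP; split => w /=; try tauto.
    by move=> [[h1 ->] h2]; split.
  by move=> [[h1 h2]]; case: (w _).
- exact: m1.
- exact: m2.
- by apply/seteqP; split=> x //= [[[_ h1] _] [[_]]]; rewrite h1.
Qed.

End Realization.

(** * Splitting one Bernoulli bit into two independent ones *)

Section BitFlip.
Context {R : realType} {I : finType}.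

Definition set_bit (i : I) (u : bool) (x : {ffun I -> bool}) : {ffun I -> bool} :=
  [ffun j => if j == i then u else x j].

(** The flip at [i] is an involution, so adding to each configuration its flip counts everything
    twice. *)
Lemma sum_set_bit (i : I) (f : {ffun I -> bool} -> R) :
  \sum_x (f (set_bit i true x) + f (set_bit i false x)) = 2 * \sum_x f x.
Proof.
pose flip (x : {ffun I -> bool}) := set_bit i (~~ x i) x.
have flipK : involutive flip.
  by move=> x; apply/ffunP => j; rewrite !ffunE eqxx; case: eqP => // ->; rewrite negbK.
rewrite mulr_natl mulr2n.
rewrite [X in _ = _ + X](reindex_inj (can_inj flipK)) -big_split /=.
apply: eq_bigr => x _.
have xE : set_bit i (x i) x = x by apply/ffunP => j; rewrite ffunE; case: eqP => // ->.
have -> : flip x = set_bit i (~~ x i) x by [].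
by case: (x i) xE => /= ->; rewrite // addrC.
Qed.

Definition bernoulli_weight (p : R) (x : {ffun I -> bool}) : R :=
  \prod_i bernoulli_pmf p (x i).

End BitFlip.

Section Split.
Context {R : realType} {I T : finType} (p : R).
Hypothesis p01 : 0 <= p <= 1.

(* The bit [b] is replaced by two independent bits [b] and [c].  If the old bit is 1, it is copied
   to [c] on the event [E] and to [b] off it; if it is 0, it is copied to [c] with the conditional
   probability [q] of [E] given that it is 1, so that the choice becomes independent of the bit. *)
Lemma split_bit (m : {ffun I -> bool} -> T -> R) (b c : I) (E : pred T) :
  b != c -> (forall x y, 0 <= m x y) ->
  (forall x, \sum_y m x y = bernoulli_weight p x) ->
  exists m' : {ffun I -> bool} -> T -> R,
  [/\ forall x y, 0 <= m' x y,
      forall x, \sum_y m' x y = bernoulli_weight p x,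
      forall y, \sum_x m' x y = \sum_x m x y &
      forall x' y, m' x' y != 0 -> exists x, [/\ m x y != 0,
        forall i, i != b -> i != c -> x' i = x i &
        x b -> if E y then x' c else x' b]].
Proof.
move=> bc m0 mS.
pose upd u v (x : {ffun I -> bool}) := set_bit b u (set_bit c v x).
have upd_b u v x : upd u v x b = u by rewrite ffunE eqxx.
have upd_c u v x : upd u v x c = v.
  by rewrite !ffunE eqxx; move: bc; rewrite eq_sym => /negbTE ->.
have upd_i u v x i : i != b -> i != c -> upd u v x i = x i.
  by move=> /negbTE ib /negbTE ic; rewrite !ffunE ib ic.
have upd_upd u v u' v' x : upd u v (upd u' v' x) = upd u v x.
  by apply/ffunP => i; rewrite !ffunE; do 2?case: eqP.
(* The mass with old bit [u] at [b]. The old value at [c] is summed out, because it is going to be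
   overwritten. *)
pose n u x y := m (upd u true x) y + m (upd u false x) y.
have n0 u x y : 0 <= n u x y by apply: addr_ge0.
pose r (x : {ffun I -> bool}) := \prod_(i | (i != b) && (i != c)) bernoulli_pmf p (x i).
have weightE x : bernoulli_weight p x = bernoulli_pmf p (x b) * (bernoulli_pmf p (x c) * r x).
  rewrite /bernoulli_weight (bigD1 b) //= (bigD1 c) 1?eq_sym //.
have r_upd u v x : r (upd u v x) = r x.
  by apply: eq_bigr => i /andP[ib ic]; rewrite upd_i.
have r0 x : 0 <= r x by apply: prodr_ge0 => i _; exact: bernoulli_pmf_ge0.
have nS u x : \sum_y n u x y = bernoulli_pmf p u * r x.
  rewrite big_split /= !mS !weightE !upd_b !upd_c !r_upd /bernoulli_pmf; ring.
pose al x := \sum_(y | E y) n true x y.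
pose be x := \sum_(y | ~~ E y) n true x y.
have al0 x : 0 <= al x by apply: sumr_ge0.
have be0 x : 0 <= be x by apply: sumr_ge0.
have albe x : al x + be x = p * r x.
  by rewrite -(nS true) (bigID E).
(* When [p * r x] is 0 the quotient is 0 by convention, and [al x] vanishes as well, so [qE] holds
   in all cases. *)
pose q x := al x / (p * r x).
have qE x : q x * (p * r x) = al x.
  have [pr0|pr0] := eqVneq (p * r x) 0; last by rewrite divfK.
  have := albe x; have := al0 x; have := be0 x; rewrite pr0 mulr0; lra.
have q0 x : 0 <= q x.
  by rewrite divr_ge0 // mulr_ge0 //; case/andP: p01.
have q1 x : q x <= 1.
  have [pr0|pr0] := eqVneq (p * r x) 0; first by rewrite /q pr0 invr0 mulr0.
  have := albe x; have := be0 x => h1 h2.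
  rewrite ler_pdivrMr; first lra.
  by rewrite lt_neqAle eq_sym pr0 /= -h2 addr_ge0.
have n_upd w u v x y : n w (upd u v x) y = n w x y by rewrite /n !upd_upd.
have al_upd u v x : al (upd u v x) = al x.
  by apply: eq_bigr => y _; rewrite n_upd.
have q_upd u v x : q (upd u v x) = q x by rewrite /q al_upd r_upd.
clearbody q.
(* The recipient gets the old bit and the other place a fresh Bernoulli([p]) bit. In the mixed cases
   the first term comes from old bit 1 and the second from old bit 0. *)
pose m' (x : {ffun I -> bool}) y := match x b, x c with
  | true, true => p * n true x y
  | false, true => (1 - p) * (if E y then n true x y else 0) + p * (1 - q x) * n false x y
  | true, false => (1 - p) * (if E y then 0 else n true x y) + p * q x * n false x y
  | false, false => (1 - p) * n false x y
  end.
have [p0 p1] : 0 <= p /\ 0 <= 1 - p by case/andP: p01 => h1 h2; rewrite subr_ge0.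
exists m'; split.
- move=> x y; have h1 := q0 x; have h2 := q1 x; have h3 : 0 <= 1 - q x by rewrite subr_ge0.
  have h4 := n0 true x y; have h5 := n0 false x y.
  rewrite /m'; case: (x b); case: (x c); rewrite ?addr_ge0 ?mulr_ge0 //; case: (E y) => //.
- move=> x; rewrite weightE /m'.
  have hq := qE x; have hs := albe x.
  have alE : \sum_y (if E y then n true x y else 0) = al x by rewrite -big_mkcond.
  have beE : \sum_y (if E y then 0 else n true x y) = be x.
    by rewrite [RHS]big_mkcond; apply: eq_bigr => y _; case: (E y).
  case: (x b); case: (x c); rewrite ?big_split -?mulr_sumr ?nS /= -?mulr_sumr ?nS ?alE ?beE //=.
  + have -> : be x = p * r x - al x by lra.
    rewrite -hq; ring.
  + rewrite -hq; ring.
- move=> y.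
  (* Mass moves only among the four settings of the bits at [b] and [c], so it is enough to compare
     sums over these; two uses of [sum_set_bit] multiply both totals by four. *)
  suff H (f g : {ffun I -> bool} -> R) :
    (forall x, \sum_u \sum_v f (upd u v x) = \sum_u \sum_v g (upd u v x)) ->
    \sum_x f x = \sum_x g x.
    apply: H => x; rewrite !big_bool /m' /= !upd_b !upd_c !q_upd !n_upd /n.
    case: (E y); ring.
  move=> H; suff : 2 * (2 * \sum_x f x) = 2 * (2 * \sum_x g x) by lra.
  rewrite -(sum_set_bit b f) -(sum_set_bit b g) -!(sum_set_bit c).
  apply: eq_bigr => x _; have := H x; rewrite !big_bool /= /upd /=; lra.
- move=> x' y m'0.
  have mN u : n u x' y != 0 -> exists v, m (upd u v x') y != 0.
    have [h1|] := eqVneq (m (upd u true x') y) 0; last by exists true.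
    have [h2|] := eqVneq (m (upd u false x') y) 0; last by exists false.
    by rewrite /n h1 h2 addr0 eqxx.
  suff [u nu hu] : exists2 u, n u x' y != 0 & (u -> if E y then x' c else x' b).
    have [v mv] := mN u nu; exists (upd u v x'); split => //.
      by move=> i ib ic; rewrite upd_i.
    by rewrite upd_b.
  move: m'0; rewrite /m'.
  (* Old bit 0 is the preferred origin, as it makes the domination clause void. If it has no mass,
     only the terms of [m'] from old bit 1 survive. *)
  have [n0'|n0'] := eqVneq (n false x' y) 0; last by exists false.
  rewrite n0' !mulr0 !addr0.
  case: (x' b); case: (x' c); case: (E y); rewrite ?mulr0 ?eqxx //;
    by rewrite mulf_eq0 negb_or => /andP[_ h]; exists true.
Qed.

End Split.

(** * Coupling on finitely many coordinates by peeling the fibres *)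

Section FiniteCoupling.
Context {R : realType} {A B : finType} (p : R).
Hypothesis p01 : 0 <= p <= 1.

Definition join_bits (u : {ffun A -> bool}) (v : {ffun B -> bool}) : {ffun A + B -> bool} :=
  [ffun i => match i with inl a => u a | inr b => v b end].

Lemma sum_join_bits (F : {ffun A + B -> bool} -> R) :
  \sum_x F x = \sum_u \sum_v F (join_bits u v).
Proof.
rewrite pair_bigA /= (reindex (fun uv => join_bits uv.1 uv.2)) //=.
exists (fun x : {ffun A + B -> bool} => ([ffun a => x (inl a)], [ffun b => x (inr b)])).
  by move=> [u v] _; congr pair; apply/ffunP => i; rewrite !ffunE.
by move=> x _; apply/ffunP => -[i|i]; rewrite !ffunE.
Qed.

Lemma bernoulli_weight_join u v :
  bernoulli_weight p (join_bits u v) = bernoulli_weight p u * bernoulli_weight p v.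
Proof.
rewrite /bernoulli_weight big_sumType /=; congr (_ * _); apply: eq_bigr => i _;
  by rewrite ffunE.
Qed.

Lemma sum_bernoulli_weight (I : finType) :
  \sum_(x : {ffun I -> bool}) bernoulli_weight p x = 1.
Proof.
rewrite -(bigA_distr_bigA (fun _ b => bernoulli_pmf p b)) big1 // => i _.
by rewrite big_bool /= addrC subrK.
Qed.

Lemma bernoulli_weight_ge0 (I : finType) (x : {ffun I -> bool}) :
  0 <= bernoulli_weight p x.
Proof. by apply: prodr_ge0 => i _; exact: bernoulli_pmf_ge0. Qed.

Lemma finite_coupling (pi : A -> B) (g : {ffun B -> bool} -> {ffun A -> bool} -> R) :
  (forall x y, 0 <= g x y) ->
  (forall x, \sum_y g x y = bernoulli_weight p x) ->
  (forall x y, g x y != 0 -> forall a, y a -> x (pi a)) ->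
  (forall x y, g x y != 0 -> forall a a', y a -> y a' -> pi a = pi a' -> a = a') ->
  exists m : {ffun A -> bool} -> {ffun A -> bool} -> R,
  [/\ forall v u, 0 <= m v u,
      forall v, \sum_u m v u = bernoulli_weight p v,
      forall u, \sum_v m v u = \sum_x g x u &
      forall v u, m v u != 0 -> forall a, u a -> v a].
Proof.
move=> g0 gS gX gU.
(* [s] lists the elements already peeled. Bit [inl a] belongs to [a] alone and [inr b] to the rest
   of the fibre of [b]; an unpeeled element is still dominated by the rest of its fibre. *)
suff H (s : seq A) : uniq s -> exists m : {ffun A + B -> bool} -> {ffun A -> bool} -> R,
  [/\ forall x y, 0 <= m x y,
      forall x, \sum_y m x y = bernoulli_weight p x,
      forall y, \sum_x m x y = \sum_x g x y,
      forall x y, m x y != 0 -> forall a a', y a -> y a' -> pi a = pi a' -> a = a' &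
      forall x y, m x y != 0 -> forall a, y a ->
        x (if a \in s then inl a else inr (pi a))].
  (* Once all of [A] is peeled, domination involves only the bits [inl a], and the fibre bits are
     summed out. *)
  have [m [m0 mS mY _ mX]] := H (enum A) (enum_uniq A).
  exists (fun v u => \sum_w m (join_bits v w) u); split.
  - by move=> v u; apply: sumr_ge0.
  - move=> v; rewrite exchange_big /=.
    under eq_bigr => w _ do rewrite mS bernoulli_weight_join.
    by rewrite -mulr_sumr sum_bernoulli_weight mulr1.
  - by move=> u; rewrite -mY sum_join_bits.
  - move=> v u nz a ua.
    have [w mw] : exists w, m (join_bits v w) u != 0.
      apply/existsP; apply: contraNT nz => /existsPn nz.
      by rewrite big1 // => w _; apply/eqP; have := nz w; rewrite negbK.
    by have := mX _ _ mw a ua; rewrite mem_enum ffunE.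
elim: s => [_|a s IH /= /andP[as_ us]].
  (* Before any peeling the bits [inl a] are independent of the fibre bits and of the field. *)
  exists (fun x y => bernoulli_weight p [ffun a => x (inl a)] * g [ffun b => x (inr b)] y).
  have E1 u v : [ffun a => join_bits u v (inl a)] = u.
    by apply/ffunP => i; rewrite !ffunE.
  have E2 u v : [ffun b => join_bits u v (inr b)] = v.
    by apply/ffunP => i; rewrite !ffunE.
  split.
  - by move=> x y; rewrite mulr_ge0 // bernoulli_weight_ge0.
  - move=> x; rewrite -mulr_sumr gS -bernoulli_weight_join; congr bernoulli_weight.
    by apply/ffunP => -[i|i]; rewrite !ffunE.
  - move=> y; rewrite sum_join_bits.
    under eq_bigr => u _ do under eq_bigr => v _ do rewrite E1 E2.
    under eq_bigr => u _ do rewrite -mulr_sumr.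
    by rewrite -mulr_suml sum_bernoulli_weight mul1r.
  - by move=> x y; rewrite mulf_eq0 negb_or => /andP[_ /gU].
  - by move=> x y; rewrite mulf_eq0 negb_or => /andP[_ /gX h] a' /h; rewrite ffunE.
have [m [m0 mS mY mU mX]] := IH us.
have [m' [m'0 m'S m'Y m'X]] := split_bit p01 (m := m) (b := inr (pi a)) (c := inl a)
  (fun y : {ffun A -> bool} => y a) isT m0 mS.
exists m'; split => //.
- by move=> y; rewrite m'Y.
- by move=> x' y /m'X[x [mx _ _]]; exact: mU mx.
- move=> x' y /m'X[x [mx xx' xa]] a' ya'; rewrite inE.
  have := mX _ _ mx a' ya'; have [ea|na] /= := eqVneq a' a.
    by rewrite ea (negbTE as_) => /xa; rewrite -ea ya'.
  case: ifP => a's.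
    by rewrite xx' // (inj_eq inl_inj).
  (* For an unpeeled [a'] with [y a'], the rest bit of another fibre is unchanged. In the fibre of
     [a], uniqueness of the 1 makes [y a] false, so the bit went to the rest. *)
  have [epi|npi] := eqVneq (pi a') (pi a); last by rewrite xx' // (inj_eq inr_inj).
  rewrite epi => /xa; case: ifP => // ya.
  by rewrite (mU _ _ mx a' a ya' ya epi) eqxx in na.
Qed.

End FiniteCoupling.

(** * Finite-valued random variables and cylinder weights *)

Section FiniteMarginals.
Context {d : measure_display} {Omega : measurableType d} {R : realType}
  (P : probability Omega R).

Lemma sum_prob_fibres (T : finType) (Z : Omega -> T) (D : set Omega) :
  measurable D -> discrete_rv Z ->
  \sum_t fine (P (D `&` [set w | Z w = t])) = fine (P D).
Proof.
move=> mD mZ.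
have mDZ t : measurable (D `&` [set w | Z w = t]) by apply: measurableI.
have H (s : seq T) : uniq s -> measurable (D `&` [set w | Z w \in s]) /\
    \sum_(t <- s) fine (P (D `&` [set w | Z w = t])) = fine (P (D `&` [set w | Z w \in s])).
  elim: s => [_|t s IH /= /andP[ts us]].
    by rewrite (_ : D `&` _ = set0) ?measure0 ?big_nil //; apply/seteqP; split=> w [].
  have [ms es] := IH us.
  have -> : D `&` [set w | Z w \in t :: s] =
      (D `&` [set w | Z w = t]) `|` (D `&` [set w | Z w \in s]).
    apply/seteqP; split=> w /=; rewrite inE.
      by move=> [Dw /orP[/eqP|]]; [left|right].
    by move=> [[Dw ->]|[Dw ->]]; rewrite ?eqxx ?orbT.
  split; first exact: measurableU.
  rewrite big_cons es measureU ?fineD ?fin_num_measure //.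
  by apply/seteqP; split=> w //= [[_ ->] [_]]; rewrite (negbTE ts).
have [_ ->] := H _ (index_enum_uniq T).
by congr (fine (P _)); apply/seteqP; split=> w /=; [case|rewrite mem_index_enum].
Qed.

Lemma prob_preimage (T : finType) (Z : Omega -> T) (E : pred T) :
  discrete_rv Z ->
  fine (P [set w | E (Z w)]) = \sum_(t | E t) fine (P [set w | Z w = t]).
Proof.
move=> mZ.
have mE : measurable [set w | E (Z w)].
  rewrite (_ : [set w | _] = \bigcup_(t in [set t | E t]) [set w | Z w = t]).
    by apply: fin_bigcup_measurable => //; exact: finite_finset.
  by apply/seteqP; split=> w /= => [h|[t Et ->]//]; exists (Z w).
rewrite -(sum_prob_fibres mE mZ) [RHS]big_mkcond /=; apply: eq_bigr => t _.
case: ifPn => Et.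
  by congr (fine (P _)); apply/seteqP; split=> w /= => [[]//|h]; rewrite h.
rewrite (_ : _ `&` _ = set0) ?measure0 //.
by apply/seteqP; split=> w //= [h1 h2]; rewrite -h2 h1 in Et.
Qed.

Lemma discrete_rv_ffun (I : finType) (Z : I -> Omega -> bool) :
  (forall i, discrete_rv (Z i)) -> discrete_rv (fun w => [ffun i => Z i w]).
Proof.
move=> mZ t.
rewrite (_ : [set w | _] = \bigcap_(i in [set: I]) [set w | Z i w = t i]).
  by apply: fin_bigcap_measurable => [|i _]; [exact: finite_finset|exact: mZ].
apply/seteqP; split=> w /= h; first by move=> i _; rewrite /= -h ffunE.
by apply/ffunP => i; rewrite ffunE; exact: h.
Qed.

End FiniteMarginals.

Lemma prod_seq_sub (R : comNzRingType) (A : choiceType) (s F : seq A) (G : A -> R) :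
  uniq F -> {subset F <= s} ->
  \prod_(a : seq_sub s | val a \in F) G (val a) = \prod_(a <- F) G a.
Proof.
move=> uF Fs; rewrite -(big_map val (mem F) G) /= -big_filter; apply: perm_big.
apply: uniq_perm => //; first by rewrite filter_uniq // map_inj_uniq ?index_enum_uniq //; exact: val_inj.
move=> a; rewrite mem_filter; have [aF|] //= := boolP (a \in F).
by apply/mapP; exists (SeqSub (Fs _ aF)); rewrite ?mem_index_enum.
Qed.

(** The sum of products factors over the coordinates, and each free coordinate contributes total
    mass 1. *)
Lemma bernoulli_weight_cylinder (R : realType) (p : R) (I : finType) (F : pred I)
    (v : I -> bool) :
  \sum_(x : {ffun I -> bool} | [forall i, F i ==> (x i == v i)]) bernoulli_weight p x
  = \prod_(i | F i) bernoulli_pmf p (v i).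
Proof.
rewrite big_mkcond [RHS]big_mkcond /=.
transitivity (\sum_(x : {ffun I -> bool}) \prod_i
    (if F i ==> (x i == v i) then bernoulli_pmf p (x i) else 0)).
  apply: eq_bigr => x _; case: ifPn => [/forallP h|].
    by apply: eq_bigr => i _; rewrite h.
  rewrite negb_forall => /existsP[i /negbTE h].
  by rewrite (bigD1 i) //= h mul0r.
rewrite -(bigA_distr_bigA (fun i b => if F i ==> (b == v i) then bernoulli_pmf p b else 0)).
apply: eq_bigr => i _; rewrite big_bool /=; case: (F i) => /=; last by rewrite addrC subrK.
by case: (v i); rewrite /= ?addr0 ?add0r.
Qed.

(** * Finite couplings as weights on binary sequences *)

Section FiniteApproximation.
Context {A B : countType} (pi : A -> B) {R : realType} (p : R).
Hypothesis p01 : 0 <= p <= 1.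
Context {d : measure_display} {Omega : measurableType d} (P : probability Omega R)
  (X : B -> Omega -> bool) (Y : Omega -> A -> bool).
Hypothesis mX : forall b, discrete_rv (X b).
Hypothesis iidX : iid_bernoulli P p X.
Hypothesis mY : forall a, discrete_rv (Y ^~ a).
Hypothesis Y_le_X : forall w a, Y w a -> X (pi a) w.
Hypothesis Y_inj : forall w a a', Y w a -> Y w a' -> pi a = pi a' -> a = a'.

(** Each [a] owns two places in a binary sequence: [false] marks the bit of the field, [true] the
    dominating Bernoulli bit. *)
Definition bit_index (a : A) (b : bool) : nat := pickle (a, b).

(** The finite coupling on [s] becomes a finite sum of point masses on sequences. It is thus defined
    and additive on all subsets, a form that survives a limit along an ultrafilter. *)
Lemma finite_approximation (s : seq A) : exists mu : set (nat -> bool) -> R,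
  [/\ forall E, 0 <= mu E, mu setT = 1 &
      forall E D, mu E = mu (E `&` D) + mu (E `\` D)] /\
  [/\ forall F : seq A, {subset F <= s} ->
        mu [set x : nat -> bool | forall a, a \in F -> x (bit_index a false)] =
        fine (P [set w | forall a, a \in F -> Y w a]),
      forall (F : seq A) (v : A -> bool), {subset F <= s} -> uniq F ->
        mu [set x : nat -> bool | forall a, a \in F -> x (bit_index a true) = v a] =
        \prod_(a <- F) bernoulli_pmf p (v a) &
      forall a, a \in s ->
        mu [set x : nat -> bool | x (bit_index a false) /\ x (bit_index a true) = false] = 0].
Proof.
pose FB := undup (map pi s).
have piP (a : seq_sub s) : pi (val a) \in FB.
  by rewrite mem_undup map_f // (valP a).
pose pi0 (a : seq_sub s) : seq_sub FB := SeqSub (piP a).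
pose XF w : {ffun seq_sub FB -> bool} := [ffun b => X (val b) w].
pose YF w : {ffun seq_sub s -> bool} := [ffun a => Y w (val a)].
have mXF : discrete_rv XF by apply: discrete_rv_ffun => b; exact: mX.
have mYF : discrete_rv YF by apply: (@discrete_rv_ffun _ _ _ (fun a w => Y w (val a))) => a; exact: mY.
pose g x y := fine (P ([set w | XF w = x] `&` [set w | YF w = y])).
have g0 x y : 0 <= g x y by rewrite fine_ge0.
have gX x : \sum_y g x y = bernoulli_weight p x.
  rewrite sum_prob_fibres //.
  (* An extension of [x] to all of [B]; its value off [FB] is never read. *)
  pose v (b : B) := if insub b is Some b' then x b' else false.
  have vE (b : seq_sub FB) : v (val b) = x b by rewrite /v valK.
  have -> : [set w | XF w = x] = \bigcap_(b in [set` FB]) [set w | X b w = v b].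
    apply/seteqP; split=> w /= h.
      by move=> b /= bF; rewrite -[b]/(val (SeqSub bF)) vE -h ffunE.
    by apply/ffunP => b; rewrite ffunE h ?vE //= (valP b).
  rewrite iidX ?undup_uniq // prodEFin /=.
  rewrite -(prod_seq_sub _ (undup_uniq _) (fun _ => id)).
  by apply: eq_big => [b|b _]; [rewrite (valP b)|rewrite vE].
have gY y : \sum_x g x y = fine (P [set w | YF w = y]).
  by rewrite -(sum_prob_fibres P (mYF y) mXF); apply: eq_bigr => x _; rewrite setIC.
(* A pair of positive weight is attained at some sample point, so the pointwise relations between
   [X] and [Y] carry over to the support of [g]. *)
have gN x y : g x y != 0 -> exists w, XF w = x /\ YF w = y.
  move=> gn; apply: contrapT => h; move/eqP: gn; apply.
  rewrite /g (_ : _ `&` _ = set0) ?measure0 //.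
  by apply/seteqP; split=> w //= [h1 h2]; apply: h; exists w.
have [m [m0 mS mYS mle]] : exists m : {ffun seq_sub s -> bool} -> {ffun seq_sub s -> bool} -> R,
  [/\ forall v u, 0 <= m v u,
      forall v, \sum_u m v u = bernoulli_weight p v,
      forall u, \sum_v m v u = \sum_x g x u &
      forall v u, m v u != 0 -> forall a, u a -> v a].
  apply: (finite_coupling p01 (pi := pi0)) => //.
  - move=> x y /gN[w [<- <-]] a; rewrite !ffunE; exact: Y_le_X.
  - move=> x y /gN[w [_ <-]] a a'; rewrite !ffunE => h h' /(congr1 val) /= e.
    by apply: val_inj; exact: Y_inj h h' e.
(* [t.1] is the dominating configuration and [t.2] the field. Places of elements outside [s], and
   indices that code nothing, hold [false]. *)
pose code (t : {ffun seq_sub s -> bool} * {ffun seq_sub s -> bool}) : nat -> bool :=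
  fun k => if unpickle k is Some (a, b) then
    if insub a is Some a' then if b then t.1 a' else t.2 a' else false else false.
have codeE t a b : code t (bit_index (val a) b) = if b then t.1 a else t.2 a.
  by rewrite /code /bit_index pickleK valK.
pose M (t : {ffun seq_sub s -> bool} * {ffun seq_sub s -> bool}) := m t.1 t.2.
exists (fun E => \sum_(t | `[< E (code t) >]) M t); split; split.
- by move=> E; apply: sumr_ge0 => t _; exact: m0.
- rewrite -(sum_bernoulli_weight p (seq_sub s)).
  under [RHS]eq_bigr => v _ do rewrite -mS.
  by rewrite pair_bigA /=; apply: eq_bigl => t; apply/asboolP.
- move=> E D; rewrite (bigID (fun t => `[< D (code t) >])) /=; congr (_ + _).
    by apply: eq_bigl => t; rewrite -asbool_and.
  by apply: eq_bigl => t; rewrite -asbool_neg -asbool_and.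
- move=> F Fs.
  transitivity (\sum_(u : {ffun seq_sub s -> bool} | [forall a, (val a \in F) ==> u a])
      \sum_v m v u).
    rewrite exchange_big pair_big_dep /=; apply: eq_bigl => -[v u] /=.
    apply/asboolP/forallP => /= h a.
      by apply/implyP => /h; rewrite codeE.
    by move=> aF; rewrite -[a]/(val (SeqSub (Fs _ aF))) codeE /=; exact: (implyP (h _)).
  under eq_bigr => u _ do rewrite mYS gY.
  rewrite -(@prob_preimage _ _ _ _ _ _ (fun u : {ffun seq_sub s -> bool} => [forall a, (val a \in F) ==> u a]) mYF).
  congr (fine (P _)); apply/seteqP; split=> w /=.
    move=> /forallP h a aF; have := h (SeqSub (Fs _ aF)).
    by rewrite ffunE /= aF.
  by move=> h; apply/forallP => a; apply/implyP => aF; rewrite ffunE; exact: h.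
- move=> F v Fs uF.
  rewrite -(prod_seq_sub _ uF Fs).
  rewrite -(@bernoulli_weight_cylinder _ _ _ (fun a : seq_sub s => val a \in F) (fun a => v (val a))).
  under [RHS]eq_bigr => x _ do rewrite -mS.
  rewrite pair_big_dep /=; apply: eq_bigl => -[x u] /=; rewrite andbT.
  apply/asboolP/forallP => /= h a.
    by apply/implyP => /h; rewrite codeE => ->.
  by move=> aF; rewrite -[a]/(val (SeqSub (Fs _ aF))) codeE /=; apply/eqP/(implyP (h _)).
- move=> a as_; rewrite big1 // => -[v u] /asboolP /=.
  rewrite -[a]/(val (SeqSub as_)) !codeE /= => -[ua va].
  by have [//|/mle/(_ _ ua)] := eqVneq (m v u) 0; rewrite va.
Qed.

End FiniteApproximation.

(** * Passage to the limit along an ultrafilter *)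

Section InfiniteCoupling.
Import numFieldNormedType.Exports.

(** Compactness of the unit interval gives a cluster point. It is a limit: if the preimage of a
    neighbourhood were not in [G], its complement would be, against clustering. *)
Lemma ultrafilter_limit (R : realType) (G : set_system nat) (f : nat -> R) :
  UltraFilter G -> (forall n, 0 <= f n <= 1) ->
  exists2 l : R, 0 <= l & f @ G --> l.
Proof.
move=> UG f01; have PG : ProperFilter G by exact: ultra_proper.
have fG : (f @ G) `[0, 1]%classic.
  suff: G (f @^-1` `[0, 1]) by [].
  by apply: filterE => n; rewrite /= in_itv /=; exact: f01.
have [l [l01 fl]] := segment_compact (fmap_proper_filter f PG) fG.
exists l; first by move: l01; rewrite /= in_itv /= => /andP[].
move=> U lU; have [//|GC] := in_ultra_setVsetC (f @^-1` U) UG.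
by have [x []] := fl (~` U) U GC lU.
Qed.

Context {A B : countType} (pi : A -> B) {R : realType} (p : R).
Hypothesis p01 : 0 <= p <= 1.
Context {d : measure_display} {Omega : measurableType d} (P : probability Omega R)
  (X : B -> Omega -> bool) (Y : Omega -> A -> bool).
Hypothesis mX : forall b, discrete_rv (X b).
Hypothesis iidX : iid_bernoulli P p X.
Hypothesis mY : forall a, discrete_rv (Y ^~ a).
Hypothesis Y_le_X : forall w a, Y w a -> X (pi a) w.
Hypothesis Y_inj : forall w a a', Y w a -> Y w a' -> pi a = pi a' -> a = a'.

(** The ultrafilter yields limits for all subsets [E] at once, where a diagonal subsequence handles
    only countably many. Additivity passes to the limit, and each remaining identity holds for all
    large [n]. *)
Lemma finitely_additive_coupling : exists mu : set (nat -> bool) -> R,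
  [/\ forall E, 0 <= mu E, mu setT = 1 &
      forall E D, mu E = mu (E `&` D) + mu (E `\` D)] /\
  [/\ forall F : seq A,
        mu [set x : nat -> bool | forall a, a \in F -> x (bit_index a false)] =
        fine (P [set w | forall a, a \in F -> Y w a]),
      forall (F : seq A) (v : A -> bool), uniq F ->
        mu [set x : nat -> bool | forall a, a \in F -> x (bit_index a true) = v a] =
        \prod_(a <- F) bernoulli_pmf p (v a) &
      forall a : A,
        mu [set x : nat -> bool | x (bit_index a false) /\ x (bit_index a true) = false] = 0].
Proof.
pose s n : seq A := pmap unpickle (iota 0 n).
have [nu nuP] := choice (fun n =>
  finite_approximation p01 mX iidX mY Y_le_X Y_inj (s n)).
have [G [UG ooG]] := ultraFilterLemma eventually_filter.
have PG : ProperFilter G by exact: ultra_proper.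
have nu01 E n : 0 <= nu n E <= 1.
  have [[nu0 nuT nuS] _] := nuP n.
  by rewrite nu0 -nuT (nuS setT E) setTI lerDl nu0.
have /choice[mu muP] : forall E, exists l : R, 0 <= l /\ (fun n => nu n E) @ G --> l.
  by move=> E; have [l l0 fl] := ultrafilter_limit UG (nu01 E); exists l.
have s_large (F : seq A) : \forall n \near \oo, {subset F <= s n}.
  (* Each summand exceeds the code of its element, so beyond this sum every element of [F] is
     listed. *)
  exists (\sum_(a <- F) (pickle a).+1)%N => // n /= hn a aF.
  rewrite mem_pmap; apply/mapP; exists (pickle a); last by rewrite pickleK.
  rewrite mem_iota /= add0n; apply: leq_trans hn.
  by rewrite (big_rem a) //= leq_addr.
have limU (f : nat -> R) (l l' : R) : f @ G --> l -> f @ G --> l' -> l = l'.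
  exact: cvg_unique (@Rhausdorff R) _ _ _ _.
have muE E c (F : seq A) : (forall n, {subset F <= s n} -> nu n E = c) -> mu E = c.
  move=> h; have [_ hc] := muP E; apply: (limU _ _ _ hc).
  apply: cvg_near_cst; apply: ooG; apply: filterS (s_large F) => n; exact: h.
exists mu; split; split.
- by move=> E; have [] := muP E.
- by apply: (muE _ _ [::]) => n _; have [[]] := nuP n.
- move=> E D; have [_ h1] := muP E; have [_ h2] := muP (E `&` D).
  have [_ h3] := muP (E `\` D); apply: (limU _ _ _ h1).
  have -> : (fun n => nu n E) = (fun n => nu n (E `&` D)) + (fun n => nu n (E `\` D)).
    by apply/funext => n; have [[_ _ nuS] _] := nuP n; exact: nuS.
  exact: cvgD.
- by move=> F; apply: (muE _ _ F) => n; have [_ [h _ _]] := nuP n; exact: h.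
- move=> F v uF; apply: (muE _ _ F) => n Fs; have [_ [_ h _]] := nuP n; exact: h.
- move=> a; apply: (muE _ _ [:: a]) => n Fs; have [_ [_ _ h]] := nuP n; apply: h.
  by apply: Fs; rewrite inE.
Qed.

End InfiniteCoupling.

(** * Uniqueness of laws and the domination theorem *)

Lemma law_unique (A : Type) (R : realType)
    (d1 : measure_display) (O1 : measurableType d1) (P1 : probability O1 R)
    (d2 : measure_display) (O2 : measurableType d2) (P2 : probability O2 R)
    (G : set (set (A -> bool))) (U1 : O1 -> A -> bool) (U2 : O2 -> A -> bool) :
  setI_closed G ->
  (forall E, G E -> [/\ measurable (U1 @^-1` E), measurable (U2 @^-1` E) &
    law P1 U1 E = law P2 U2 E]) ->
  forall E, <<s G>> E -> law P1 U1 E = law P2 U2 E.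
Proof.
move=> GI GE.
(* Dynkin's argument: these events form a Dynkin system. Measurability of the preimages is carried
   along because complements and disjoint unions need it. *)
pose D := [set E | [/\ measurable (U1 @^-1` E), measurable (U2 @^-1` E) &
    law P1 U1 E = law P2 U2 E]].
suff H : <<s G>> `<=` D by move=> E /H[].
rewrite -setI_closed_g_dynkin_g_sigma_algebra //; apply: smallest_sub => //; split.
- by rewrite /D /law /= !preimage_setT !probability_setT; split.
- move=> E [m1 m2 e]; split; rewrite /law preimage_setC; try exact: measurableC.
  by rewrite preimage_setC !probability_setC //; congr (_ - _)%E.
- move=> F tF FD.
  have m1 n : measurable (U1 @^-1` F n) by have [] := FD n.
  have m2 n : measurable (U2 @^-1` F n) by have [] := FD n.
  split; rewrite /law preimage_bigcup; try exact: bigcupT_measurable.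
  have tU (O : Type) (U : O -> A -> bool) : trivIset setT (fun n => U @^-1` F n).
    by move=> i j _ _ [x [Fi Fj]]; apply: tF => //; exists (U x).
  rewrite preimage_bigcup !measure_bigcup //.
  by apply: eq_eseriesr => n _; have [] := FD n.
Qed.

(** The one-coordinate generators are not closed under intersection in general; the events that all
    coordinates of a finite list are 1 are, and so suit [law_unique]. *)
Lemma sub_prod_sigma_cylinders (A : eqType) :
  @prod_sigma A `<=`
  <<s [set [set f : A -> bool | forall a, a \in F -> f a] | F in [set: seq A]] >>.
Proof.
apply: smallest_sub; first exact: smallest_sigma_algebra.
move=> _ [a _ <-]; apply: sub_gen_smallest; exists [:: a] => //.
apply/seteqP; split=> f /=; first by move=> h; apply: h; rewrite inE.
by move=> fa b; rewrite inE => /eqP ->.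
Qed.

Theorem theorem1p1 (A B : countType) (pi : A -> B)
  (hA : inhabited A) (hB : inhabited B)
  (hpi : forall b : B, exists a : A, pi a = b)
  (R : realType) (p : R) (hp : 0 <= p <= 1)
  (d : measure_display) (Omega : measurableType d) (P : probability Omega R)
  (X : B -> Omega -> bool)
  (hXrv : forall b : B, discrete_rv (X b))
  (hXiid : iid_bernoulli P p X)
  (S : B -> Omega -> A)
  (hSrv : forall b : B, discrete_rv (S b))
  (hSfib : forall (b : B) (w : Omega), pi (S b w) = b) :
  dominated_by_bernoulli_product P (thinned pi X S) p.
Proof.
pose Y := thinned pi X S.
have mYt a : measurable [set w | Y w a].
  rewrite (_ : [set w | _] = [set w | S (pi a) w = a] `&` [set w | X (pi a) w = true]).
    by apply: measurableI; [exact: hSrv|exact: hXrv].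
  apply/seteqP; split=> w; rewrite /Y /thinned /=; first by move=> /andP[/eqP -> ->].
  by move=> [-> ->]; rewrite eqxx.
have mY a : discrete_rv (Y ^~ a).
  move=> [|]; first exact: mYt.
  rewrite (_ : [set w | _] = ~` [set w | Y w a]); first exact: measurableC.
  by apply/seteqP; split=> w /= => [->//|/negP/negbTE].
have Y_le_X w a : Y w a -> X (pi a) w by move=> /andP[].
have Y_inj w a a' : Y w a -> Y w a' -> pi a = pi a' -> a = a'.
  by move=> /andP[/eqP h _] /andP[/eqP h' _] e; rewrite -h -h' e.
have [mu [[mu0 muT muS] [muY muV muYV]]] :=
  finitely_additive_coupling hp hXrv hXiid mY Y_le_X Y_inj.
pose Q : probability (measurableTypeR R) R := uniform_prob (@ltr01 R).
have QE (F : seq nat) (E : set (nat -> bool)) :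
    (forall x x' : nat -> bool, {in F, x =1 x'} -> E x -> E x') ->
    measurable [set x : measurableTypeR R | E (digit mu x)] /\
    Q [set x | E (digit mu x)] = (mu E)%:E.
  move=> EF; apply: (uniform01_digit mu0 muT muS (k := (\sum_(i <- F) i.+1)%N)).
  move=> x x' h; apply: EF => i iF; apply: h.
  by rewrite (big_rem i) //= leq_addr.
(* Both fields are read off the digits of one uniform real, which puts them on a common probability
   space. *)
pose bit b (x : measurableTypeR R) (a : A) := digit mu x (bit_index a b).
exists _, (measurableTypeR R), Q, (bit false), (bit true).
have mbit b a : discrete_rv (fun x => bit b x a) by move=> t; exact: measurable_digit.
split; [exact: mbit|exact: mbit| | |].
- move=> E /sub_prod_sigma_cylinders; apply: law_unique.
    move=> _ _ [F1 _ <-] [F2 _ <-]; exists (F1 ++ F2) => //.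
    apply/seteqP; split=> f /=.
      by move=> h; split=> a aF; apply: h; rewrite mem_cat aF ?orbT.
    by move=> [h1 h2] a; rewrite mem_cat => /orP[/h1|/h2].
  move=> _ [F _ <-].
  have [mE QF] := QE [seq bit_index a false | a <- F]
    [set x : nat -> bool | forall a, a \in F -> x (bit_index a false)]
    (fun x x' h hx a aF => eq_ind _ is_true (hx a aF) _ (h _ (map_f _ aF))).
  have mYF : measurable [set w | forall a, a \in F -> Y w a].
    rewrite (_ : [set w | _] = \bigcap_(a in [set` F]) [set w | Y w a]) //.
    by apply: fin_bigcap_measurable.
  split; [exact: mE|exact: mYF|].
  by rewrite /law QF muY fineK //; exact: fin_num_measure.
- move=> F uF v.
  have [mE QF] := QE [seq bit_index a true | a <- F]
    [set x : nat -> bool | forall a, a \in F -> x (bit_index a true) = v a]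
    (fun x x' h hx a aF => etrans (esym (h _ (map_f _ aF))) (hx a aF)).
  by rewrite [LHS]QF muV // prodEFin.
- have Qa (a : A) : Q.-negligible [set x | bit false x a /\ bit true x a = false].
    have [mE QF] := QE [:: bit_index a false; bit_index a true]
      [set x : nat -> bool | x (bit_index a false) /\ x (bit_index a true) = false]
      (fun x x' h hx => conj (eq_ind _ is_true hx.1 _ (h _ (mem_head _ _)))
        (etrans (esym (h (bit_index a true) (mem_last _ [:: _]))) hx.2)).
    by apply/(negligibleP Q mE); rewrite [LHS]QF muYV.
  (* The exceptional null sets are indexed by [nat] to form a countable union; a number that codes
     no element contributes the empty set. *)
  pose N n := [set x | if unpickle n is Some a then
    bit false x a /\ bit true x a = false else False].
  apply: (negligibleS _ (negligible_bigcup (F := N) _)).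
    move=> x /= /existsNP[a /negP]; rewrite negb_imply => /andP[fa /negbTE ta].
    by exists (pickle a) => //; rewrite /N /= pickleK.
  by move=> n; rewrite /N; case: (unpickle n) => [a|]; [exact: Qa|exact: negligible_set0].
Qed.
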